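(* Let $n\geq 1$ and $\mathbf{z}=(z_1,\dots,z_n)$. The space $\mathbb{C}\{\mathbf{z}\}$ is an analytic Baire space; that is, $\mathbb{C}\{\mathbf{z}\}$ is not the union of countably many analytic subspaces.
   Context: $\mathbb{C}\{\mathbf{z}\}$ is the space of convergent power series (germs at $0\in\mathbb{C}^n$ of holomorphic functions), with the norm $\|f\|:=\sum_{\mathbf{J}\in\mathbb{N}^n}\frac{|a_{\mathbf{J}}|}{\mathbf{J}!}$ for $f=\sum_{\mathbf{J}}a_{\mathbf{J}}\mathbf{z}^{\mathbf{J}}$, where $\mathbf{J}!=\prod_\ell j_\ell!$. Let $\Omega$ be a domain of $\mathbb{C}^p$, $p\geq 1$. A map $F:\Omega\to\mathbb{C}\{\mathbf{z}\}$ is analytic if for every $\mathbf{x}\in\Omega$ there is a $\mathbb{C}$-linear map $L:\mathbb{C}^p\to\mathbb{C}\{\mathbf{z}\}$ such that $F(\mathbf{x}+\mathbf{h})=F(\mathbf{x})+L(\mathbf{h})+o(\mathbf{h})$ as $\mathbf{h}\to 0$, with respect to the norm $\|\cdot\|$. An analytic subspace of $\mathbb{C}\{\mathbf{z}\}$ is the range $F(\Omega)$ of an analytic map $F:\Omega\to\mathbb{C}\{\mathbf{z}\}$, where $\Omega\subset\mathbb{C}^p$ is a domain for some $p\geq 1$ ($p$ may depend on the subspace). *)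

(* Defs.v *)
From HB Require Import structures.
From mathcomp Require Import all_boot all_order all_algebra complex.
From mathcomp Require Import all_classical all_reals all_analysis.
Import Order.TTheory GRing.Theory Num.Theory.
Import numFieldNormedType.Exports.
Import ComplexField.Normc.

Set Implicit Arguments.
Unset Strict Implicit.
Unset Printing Implicit Defensive.

Local Open Scope classical_set_scope.
Local Open Scope ring_scope.
Local Open Scope complex_scope.

(* The topology on C = R[i] and C^p = 'rV[R[i]]_p is the one of the modulus and
   of the sup norm; the generic instances are not inferred for the concrete
   type R[i]. *)
#[export, non_forgetful_inheritance]
HB.instance Definition _ (R : rcfType) := NormedModule.copy R[i] R[i]^o.

Definition mindex (n : nat) := {ffun 'I_n -> nat}.
HB.instance Definition _ n := Choice.on (mindex n).

Definition mfact n (J : mindex n) : nat := (\prod_(l < n) (J l)`!)%N.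

Definition mmonom (R : realType) n (z : 'rV[R[i]]_n) (J : mindex n) : R[i] :=
  \prod_(l < n) z 0 l ^+ J l.

Definition convergent (R : realType) n (a : mindex n -> R[i]) : Prop :=
  \forall z \near (0 : 'rV[R[i]]_n),
    summable setT (fun J => (normc (a J * mmonom z J))%:E).

Definition convergent_pred (R : realType) n : {pred mindex n -> R[i]} :=
  fun a => `[< convergent a >].

(* A germ at 0 is identified with the family of its Taylor coefficients. *)
Record cvps (R : realType) (n : nat) := Cvps {
  coef :> mindex n -> R[i];
  _ : coef \in @convergent_pred R n }.

HB.instance Definition _ R n := [isSub for @coef R n].
HB.instance Definition _ R n := [Choice of cvps R n by <:].

Section cvps_lmod.
Variables (R : realType) (n : nat).
Implicit Types (a b : mindex n -> R[i]) (f g : cvps R n).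
Local Notation term a J := (normc (a J) / (mfact J)%:R).

Lemma normc_ge0 (x : R[i]) : 0 <= normc x.
Proof. by case: x => x y; exact: sqrtr_ge0. Qed.

Lemma esumZ (T : choiceType) (D : set T) (c : R) (u : T -> R) :
  0 <= c -> (forall i, 0 <= u i) ->
  (\esum_(i in D) (c * u i)%:E = c%:E * \esum_(i in D) (u i)%:E)%E.
Proof.
move=> c0 u0; rewrite /esum -ereal_supZl//; last first.
  by apply/set0P/image_nonempty; exists set0; exact: fsets_set0.
congr ereal_sup; rewrite image_comp; apply: eq_imagel => A _ /=.
by rewrite ge0_mule_fsumr.
Qed.

Lemma convergentZ (c : R[i]) a : convergent a -> convergent (c *: a).
Proof.
move=> ca; rewrite /convergent; near=> z.
have : summable setT (fun J => (normc (a J * mmonom z J))%:E) by near: z.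
rewrite /summable => sa.
rewrite (@eq_esum _ _ _ _ (fun J => (normc c * normc (a J * mmonom z J))%:E)).
  rewrite esumZ ?normc_ge0//; last by move=> J; exact: normc_ge0.
  apply: lte_mul_pinfty; rewrite ?lee_fin ?normc_ge0//.
  by under eq_esum do rewrite -[X in X%:E]ger0_norm ?normc_ge0//.
move=> J _ /=; rewrite ger0_norm ?normc_ge0//.
by rewrite [X in normc (X * _)](_ : _ = c * a J)// -mulrA normcM.
Unshelve. all: by end_near. Qed.

Lemma convergentD a b : convergent a -> convergent b -> convergent (a + b).
Proof.
move=> ca cb; rewrite /convergent; near=> z.
have sa : summable setT (fun J => (normc (a J * mmonom z J))%:E) by near: z.
have sb : summable setT (fun J => (normc (b J * mmonom z J))%:E) by near: z.
apply: le_lt_trans (summableD sa sb).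
apply: le_esum => J _ /=; rewrite lee_fin.
rewrite !ger0_norm ?addr_ge0 ?normc_ge0//.
by rewrite [X in normc (X * _)](_ : _ = a J + b J)// mulrDl le_normcD.
Unshelve. all: by end_near. Qed.

Lemma convergent0 : convergent (0 : mindex n -> R[i]).
Proof.
near=> z; rewrite /summable esum1 ?ltry// => J _.
by rewrite [X in normc (X * _)](_ : _ = 0)// mul0r normc0/= normr0.
Unshelve. all: by end_near.
Qed.

Lemma convergent_submod_closed : submod_closed (@convergent_pred R n).
Proof.
split; first by apply/asboolP; exact: convergent0.
move=> c a b /asboolP ca /asboolP cb; apply/asboolP.
exact/convergentD/cb/convergentZ.
Qed.

HB.instance Definition _ := GRing.isSubmodClosed.Build R[i] (mindex n -> R[i])
  (@convergent_pred R n) convergent_submod_closed.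
HB.instance Definition _ := [SubChoice_isSubLmodule of cvps R n by <:].

Definition cvps_norm f : R := fine (\esum_(J in [set: mindex n]) (term f J)%:E).

Lemma term_ge0 a J : 0 <= term a J.
Proof. by rewrite divr_ge0 ?normc_ge0. Qed.

Lemma expr_fact_le (x : R) k : 0 <= x -> x ^+ k / k`!%:R <= expR x.
Proof.
move=> x0; case: k => [|k].
  by rewrite expr0 fact0 divr1; apply: le_trans (expR_ge1Dx x); rewrite lerDl.
by apply: le_trans (expR_ge1Dxn k x0); rewrite lerDr.
Qed.

Lemma convergent_polydisc a : convergent a -> exists2 r : R, 0 < r &
  (\esum_(J in setT) (normc (a J) * r ^+ (\sum_l J l))%:E < +oo)%E.
Proof.
move=> /nbhs_ballP[e /= e0 ea].
have [r r0 re] : exists2 r : R, 0 < r & r%:C < e.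
  case: e e0 {ea} => x y; rewrite ltcE/= => /andP[/eqP-> x0].
  exists (x / 2); first by rewrite divr_gt0.
  by rewrite ltcE/= eqxx/= ltr_pdivrMr// ltr_pMr// ltr1n.
exists r => //.
have /ea : ball (0 : 'rV[R[i]]_n) e (const_mx r%:C).
  split=> // i j; rewrite !mxE -ball_normE/= sub0r normrN.
  by rewrite ger0_norm// ler0c ltW.
rewrite /summable; congr (_ < _)%E; apply: eq_esum => J _ /=.
rewrite ger0_norm ?normc_ge0// normcM; congr (_ * _)%:E.
rewrite /mmonom (eq_bigr (fun l => r%:C ^+ J l)); last first.
  by move=> l _; congr (_ ^+ _); rewrite mxE.
by rewrite prodrXr -rmorphXn/= expr0n/= addr0 sqrtr_sqr ger0_norm ?exprn_ge0 ?ltW.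
Qed.

Lemma cvps_esum_fin f : (\esum_(J in setT) (term f J)%:E)%E \is a fin_num.
Proof.
have [r r0 fr] : exists2 r : R, 0 < r &
    (\esum_(J in setT) (normc (f J) * r ^+ (\sum_l J l))%:E < +oo)%E.
  by apply/convergent_polydisc/asboolP; exact: (valP f).
rewrite ge0_fin_numE; last by apply: esum_ge0 => J _; rewrite lee_fin term_ge0.
pose M : R := expR r^-1 ^+ n.
apply: (@le_lt_trans _ _
  (M%:E * \esum_(J in setT) (normc (f J) * r ^+ (\sum_l J l))%:E)%E); last first.
  by apply: lte_mul_pinfty; rewrite ?lee_fin ?exprn_ge0 ?expR_ge0.
rewrite -esumZ ?exprn_ge0 ?expR_ge0//; last first.
  by move=> J; rewrite mulr_ge0 ?normc_ge0 ?exprn_ge0 ?ltW.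
apply: le_esum => J _; rewrite lee_fin mulrCA ler_wpM2l ?normc_ge0//.
rewrite -ler_pdivrMr ?exprn_gt0// -exprVn -prodrXr /mfact natr_prod -prodfV.
rewrite -big_split/= /M -[X in _ <= _ ^+ X]card_ord -prodr_const.
apply: ler_prod => l _; rewrite mulrC expr_fact_le ?invr_ge0 ?(ltW r0)// andbT.
by rewrite divr_ge0 ?exprn_ge0 ?invr_ge0 ?(ltW r0).
Qed.

Lemma cvps_normE f :
  ((cvps_norm f)%:E = \esum_(J in [set: mindex n]) (term f J)%:E)%E.
Proof. by rewrite fineK// cvps_esum_fin. Qed.

Lemma cvps_normD f g : cvps_norm (f + g) <= cvps_norm f + cvps_norm g.
Proof.
rewrite -lee_fin EFinD !cvps_normE -esumD; first last.
- by move=> J _; rewrite lee_fin term_ge0.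
- by move=> J _; rewrite lee_fin term_ge0.
apply: le_esum => J _; rewrite -EFinD lee_fin -mulrDl ler_wpM2r//.
by rewrite [X in normc X](_ : _ = f J + g J)// le_normcD.
Qed.

Lemma cvps_normZ (c : R[i]) f : cvps_norm (c *: f) = normc c * cvps_norm f.
Proof.
apply: EFin_inj; rewrite EFinM !cvps_normE -esumZ ?normc_ge0//; last first.
  by move=> J; exact: term_ge0.
apply: eq_esum => J _; rewrite [X in normc X](_ : _ = c * f J)//.
by rewrite normcM mulrA.
Qed.

Lemma cvps_norm_eq0 f : cvps_norm f = 0 -> f = 0.
Proof.
move=> h0; have f0 := cvps_normE f; rewrite {}h0 in f0.
apply: val_inj; apply: funext => J; apply: eq0_normc.
have : ((term f J)%:E <= (0 : R)%:E)%E.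
  rewrite [leRHS]f0; apply: esum_ge; exists [set J]; first by split.
  by rewrite fsbig_set1.
rewrite lee_fin pmulr_lle0; last first.
  by rewrite invr_gt0 ltr0n; apply: prodn_gt0 => l; exact: fact_gt0.
by move=> fJ0; apply/eqP; rewrite eq_le fJ0 normc_ge0.
Qed.

Let normC f : R[i] := (cvps_norm f)%:C.

Let normC_D f g : normC (f + g) <= normC f + normC g.
Proof. by rewrite -rmorphD lecR cvps_normD. Qed.

Let normC_Z (c : R[i]) f : normC (c *: f) = `|c| * normC f.
Proof. by rewrite /normC cvps_normZ rmorphM. Qed.

Let normC_eq0 f : normC f = 0 -> f = 0.
Proof. by move=> /complexI/cvps_norm_eq0. Qed.

HB.instance Definition _ :=
  Lmodule_isNormed.Build R[i] (cvps R n) normC_D normC_Z normC_eq0.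

Lemma cvps_normrE f : `|f| = (cvps_norm f)%:C.
Proof. by []. Qed.

End cvps_lmod.

Section analytic_subspaces.
Variables (R : realType) (V : normedModType R[i]).
Local Notation "''C^' p" := ('rV[R[i]]_p : normedModType R[i])
  (at level 8, p at level 2).

Definition domain p (Omega : set 'C^p) : Prop :=
  [/\ Omega !=set0, open Omega & connected Omega].

(* F is total, but Omega will be open, so only its values on Omega matter. *)
Definition analytic_map p (Omega : set 'C^p) (F : 'C^p -> V) : Prop :=
  forall x, Omega x -> exists L : {linear 'C^p -> V},
    forall h : 'C^p, F (x + h) = F x + L h +o_(h \near 0) h.

Definition analytic_subspace (S : set V) : Prop :=
  exists (p : nat) (Omega : set 'C^p) (F : 'C^p -> V),
    [/\ (0 < p)%N, domain Omega, analytic_map Omega F & S = F @` Omega].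

Definition analytic_Baire_space : Prop :=
  ~ exists A : set (set V),
      [/\ countable A, (forall S, A S -> analytic_subspace S) &
          \bigcup_(S in A) S = setT].

End analytic_subspaces.
Arguments analytic_Baire_space {R} V.

(* Main.v *)
(** A Frechet differentiable map is Lipschitz at small scales on each of
    countably many bounded pieces E_k of its domain.  Such a piece lies in a real
    space of dimension 2p and is covered by O(Q^(2p)) cells of side of order 1/Q,
    whereas a grid of mesh 1/Q in a cube of dimension 2p+1 has about Q^(2p+1)
    points.  By the pigeonhole principle, however one selects 2p+1 Taylor
    coefficients, some prescribed values in [0,1] for them are attained by no
    element of F(E_k).  Assigning disjoint blocks of the coefficients of
    (z_1...z_n)^m, m >= 0, to the countably many pieces gives a power series with
    coefficients in [0,1], hence convergent, which avoids all of them. *)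
Require Import Defs.
From mathcomp Require Import all_boot all_order all_algebra complex.
From mathcomp Require Import all_classical all_reals all_analysis.
From mathcomp Require Import zify ring lra.
Import Order.TTheory GRing.Theory Num.Theory.
Import numFieldNormedType.Exports.
Import ComplexField.Normc.

Set Implicit Arguments.
Unset Strict Implicit.
Unset Printing Implicit Defensive.

Local Open Scope classical_set_scope.
Local Open Scope ring_scope.
Local Open Scope complex_scope.

(** * Counting cells against grid points *)

Lemma truncn_eq_dist_lt1 (R : realType) (x y : R) :
  0 <= x -> 0 <= y -> Num.truncn x = Num.truncn y -> `|x - y| < 1.
Proof.
move=> /truncn_itv + /truncn_itv + xy; rewrite xy => /andP[x1 x2] /andP[y1 y2].
by rewrite -natr1 in x2 y2; rewrite ltr_norml; lra.
Qed.

(** If every grid point [w / Q] were attained, at [x_ w] say, the Lipschitz bound would put distinct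
    grid points in distinct cells of [phi]-space, but there are too few cells. *)
Lemma lipschitz_image_misses_cube (R : realType) (T : Type) (I J : finType)
    (E : set T) (phi : T -> I -> R) (g : T -> J -> R) (B C e : R) :
  (#|I| < #|J|)%N -> 0 < e ->
  (forall x i, E x -> `|phi x i| <= B) ->
  (forall x y d, E x -> E y -> 0 <= d -> d <= e ->
    (forall i, `|phi x i - phi y i| <= d) ->
    forall j, `|g x j - g y j| <= C * d) ->
  exists v : J -> R, (forall j, 0 <= v j <= 1) /\
    forall x, E x -> ~ (forall j, g x j = v j).
Proof.
move=> IJ e0 phiB gC.
have [K [K0 BK CK eK]] : exists K : nat,
    [/\ (0 < K)%N, B <= K%:R, C <= K%:R & e^-1 <= K%:R].
  exists (Num.truncn B + Num.truncn C + Num.truncn e^-1).+1.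
  by split=> //; rewrite (le_trans (ltW (truncnS_gt _)))// ler_nat ltnS
    ?leq_addl// -addnA ?leq_addr// addnCA leq_addr.
(* A cell of side [1 / N] gives a variation of at most [K / N = 1 / (2 * Q)], half the grid spacing.
   Each axis [[-K, K]] has [M + 1 <= 5 * K ^ 2 * Q] cells, and [(5 * K ^ 2) ^ #|I| < Q] yields
   [(5 * K ^ 2 * Q) ^ #|I| < Q ^ #|I|.+1]. *)
pose Q := ((5 * K ^ 2) ^ #|I|).+1.
pose N := (2 * K * Q)%N.
pose M := (2 * K * N)%N.
have N0 : 0 < N%:R :> R by rewrite ltr0n /N; lia.
have Q0 : 0 < Q%:R :> R by rewrite ltr0n.
apply: contrapT => noV.
have hit (w : {ffun J -> 'I_Q}) :
    exists x, E x /\ forall j, g x j = (w j)%:R / Q%:R.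
  apply: contrapT => nox; apply: noV; exists (fun j => (w j)%:R / Q%:R).
  split=> [j|x Ex gx]; last by apply: nox; exists x.
  by rewrite divr_ge0//= ler_pdivrMr// mul1r ler_nat ltnW.
have [x_ x_P] := choice hit.
(* The shift by [K] makes the coordinates nonnegative, so that truncation is the floor. *)
pose t (w : {ffun J -> 'I_Q}) i : R := (phi (x_ w) i + K%:R) * N%:R.
have t_itv w i : 0 <= t w i <= M%:R.
  have := phiB _ i (x_P w).1; rewrite ler_norml => /andP[p1 p2].
  rewrite /t /M natrM mulr_ge0 ?ler_wpM2r//= ?natrM; lra.
pose cell (w : {ffun J -> 'I_Q}) : {ffun I -> 'I_M.+1} :=
  [ffun i => inord (Num.truncn (t w i))].
have cell_inj : injective cell.
  move=> w w' /ffunP ww'; apply/ffunP => j; apply/val_inj/eqP => /=.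
  have phid i : `|phi (x_ w) i - phi (x_ w') i| <= N%:R^-1.
    have /andP[t0 tM] := t_itv w i; have /andP[t0' tM'] := t_itv w' i.
    have := ww' i; rewrite !ffunE => /(congr1 val); rewrite /= !inordK; last 2 first.
    - by rewrite ltnS -(ler_nat R) (le_trans _ tM')// truncn_le.
    - by rewrite ltnS -(ler_nat R) (le_trans _ tM)// truncn_le.
    move=> /(truncn_eq_dist_lt1 t0 t0').
    rewrite /t -mulrBl opprD addrACA subrr addr0 normrM (gtr0_norm N0).
    by rewrite -ltr_pdivlMr// div1r => /ltW.
  have Ne : N%:R^-1 <= e.
    rewrite invf_ple ?posrE//; apply: (le_trans eK); rewrite ler_nat /N; nia.
  have N0' : 0 <= N%:R^-1 :> R by rewrite invr_ge0 ltW.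
  have := gC _ _ _ (x_P w).1 (x_P w').1 N0' Ne phid j.
  rewrite (x_P w).2 (x_P w').2 -mulrBl normrM (gtr0_norm (_ : 0 < Q%:R^-1)) ?invr_gt0//.
  rewrite ler_pdivrMr// => h.
  have : `|(w j)%:R - (w' j)%:R| <= 2^-1 :> R.
    apply: (le_trans h); apply: (@le_trans _ _ (K%:R * N%:R^-1 * Q%:R)).
      by rewrite ler_wpM2r// ler_wpM2r// invr_ge0 ltW.
    rewrite le_eqVlt; apply/orP; left; apply/eqP.
    rewrite /N !natrM; field.
    by rewrite (gt_eqF Q0) pnatr_eq0 -lt0n K0.
  move=> {}h; case: (ltngtP (w j) (w' j)) => //; rewrite -(ler_nat R) -natr1 => lt.
    by move: h; rewrite ler_norml; lra.
  by move: h; rewrite ler_norml; lra.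
have := leq_card _ cell_inj; rewrite !card_ffun !card_ord leqNgt => /negP; apply.
apply: (@leq_ltn_trans ((5 * K ^ 2 * Q) ^ #|I|)).
  have : (M.+1 <= 5 * K ^ 2 * Q)%N by rewrite /M /N; nia.
  by case: #|I| => // k; rewrite leq_exp2r.
apply: (@leq_trans (Q ^ #|I|.+1)); last by rewrite leq_pexp2l.
by rewrite expnMn [ltnRHS]expnSr mulnC ltn_pmul2l ?expn_gt0.
Qed.

(** * Moduli and bounds on Taylor coefficients *)

Lemma normc_real (R : realType) (x : R) : normc x%:C = `|x|.
Proof. by rewrite /= expr0n/= addr0 sqrtr_sqr. Qed.

Lemma normc_Re (R : realType) (z : R[i]) : `|complex.Re z| <= normc z.
Proof.
by case: z => x y /=; rewrite -sqrtr_sqr ler_wsqrtr// lerDl sqr_ge0.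
Qed.

Lemma normc_Im (R : realType) (z : R[i]) : `|complex.Im z| <= normc z.
Proof.
by case: z => x y /=; rewrite -sqrtr_sqr ler_wsqrtr// lerDr sqr_ge0.
Qed.

Lemma normc_le_ReIm (R : realType) (z : R[i]) :
  normc z <= `|complex.Re z| + `|complex.Im z|.
Proof.
case: z => x y /=; rewrite -[leRHS]ger0_norm ?addr_ge0// -sqrtr_sqr.
by rewrite ler_wsqrtr// sqrrD !real_normK ?num_real// addrAC lerDl
  mulrn_wge0// mulr_ge0.
Qed.

Lemma cvps_norm_ge0 (R : realType) n (f : cvps R n) : 0 <= cvps_norm f.
Proof.
by rewrite -lee_fin cvps_normE; apply: esum_ge0 => J _; rewrite lee_fin term_ge0.
Qed.

(** One term of a nonnegative sum is at most the sum; hence each coefficient is Lipschitz for the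
    norm. *)
Lemma normc_coef_le (R : realType) n (f : cvps R n) (J : mindex n) :
  normc (f J) <= (mfact J)%:R * cvps_norm f.
Proof.
rewrite mulrC -ler_pdivrMr; last first.
  by rewrite ltr0n; apply: prodn_gt0 => l; exact: fact_gt0.
rewrite -lee_fin cvps_normE; apply: esum_ge; exists [set J]; first by split.
by rewrite fsbig_set1.
Qed.

(** * Thin sets and Lipschitz pieces *)

Section thin.
Variables (R : realType) (n : nat).
Local Notation "''C^' p" := ('rV[R[i]]_p : normedModType R[i])
  (at level 8, p at level 2).

(* Finitely many of the values [v j] suffice; the full sequence spares the
   bookkeeping of their number. *)
Definition thin (P : set (cvps R n)) : Prop :=
  forall J : nat -> mindex n, exists v : nat -> R,
    (forall j, 0 <= v j <= 1) /\
    forall f, P f -> ~ (forall j, f (J j) = (v j)%:C).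

(** A single integer [k] controls size, Lipschitz constant and scale, which keeps the pieces
    countable in number. *)
Definition lip_piece p (Omega : set 'C^p) (F : 'C^p -> cvps R n) (k : nat)
    : set 'C^p :=
  [set x | [/\ Omega x, forall l, normc (x 0 l) <= k%:R &
    forall (h : 'C^p) (d : R), 0 <= d -> d <= k.+1%:R^-1 ->
      (forall l, normc (h 0 l) <= d) ->
      cvps_norm (F (x + h) - F x) <= k%:R * d]].

Lemma thin_lip_piece p (Omega : set 'C^p) (F : 'C^p -> cvps R n) k :
  thin (F @` lip_piece Omega F k).
Proof.
move=> J.
pose phi (x : 'C^p) (i : 'I_p * bool) :=
  if i.2 then complex.Re (x 0 i.1) else complex.Im (x 0 i.1).
pose g (x : 'C^p) (j : 'I_(p * 2).+1) := complex.Re (F x (J j)).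
pose W := (\sum_(j < (p * 2).+1) mfact (J j))%N.
(* Real and imaginary parts within [d] give a modulus within [2 * d]: hence the factor 2 in the
   constant and the halved scale. [W] dominates all the factorials at once. *)
have [||x i []|x y d [_ _ Lx] [_ _ _] d0 de xy j|v [v01 vP]] :=
  @lipschitz_image_misses_cube R 'C^p _ _ (lip_piece Omega F k) phi g
    k%:R (W%:R * (k%:R * 2)) (k.+1%:R^-1 / 2).
- by rewrite card_prod card_bool !card_ord.
- by rewrite divr_gt0// invr_gt0.
- move=> _ xk _; apply: le_trans (xk i.1); rewrite /phi.
  by case: i.2; [exact: normc_Re|exact: normc_Im].
- have : cvps_norm (F (x + (y - x)) - F x) <= k%:R * (2 * d).
    apply: Lx => [||l]; [by rewrite mulr_ge0|by rewrite mulrC -ler_pdivlMr|].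
    apply: (le_trans (normc_le_ReIm _)).
    have := xy (l, true); have := xy (l, false); rewrite /phi/= distrC => h1.
    rewrite distrC => h2; rewrite !mxE !raddfB /=; lra.
  rewrite (addrC x) subrK => Fxy; rewrite /g distrC.
  apply: (@le_trans _ _ (normc ((F y - F x) (J j)))).
    by rewrite -raddfB; exact: normc_Re.
  apply: (le_trans (normc_coef_le _ _)).
  rewrite -!mulrA; apply: ler_pM => //; first exact: cvps_norm_ge0.
  by rewrite ler_nat /W (bigD1 j)//= leq_addr.
(* Past the first [2p+1] indices [inord] returns a default; the contradiction only uses those
   before. *)
- exists (fun j => v (inord j)); split => // _ [x xE <-] Fx.
  by apply: (vP x xE) => j; rewrite /g Fx/= inord_val.
Qed.

End thin.

(** * Covering the domain of an analytic map by Lipschitz pieces *)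

Section analytic_pieces.
Variables (R : realType) (n : nat).
Local Notation "''C^' p" := ('rV[R[i]]_p : normedModType R[i])
  (at level 8, p at level 2).

Lemma near0_row p (P : 'C^p -> Prop) : (\forall h \near 0, P h) ->
  exists2 r : R, 0 < r & forall h : 'C^p, (forall l, normc (h 0 l) < r) -> P h.
Proof.
move=> /nbhs_ballP[e /= e0 eP]; exists (complex.Re e).
  by case: e e0 {eP} => x y; rewrite ltcE => /andP[].
have eE : e = (complex.Re e)%:C.
  by case: e e0 {eP} => x y; rewrite ltcE/= => /andP[/eqP->].
move=> h hr; apply: eP; split=> // i j; rewrite ord1 mxE -ball_normE/= sub0r normrN.
by rewrite eE ltcR.
Qed.

Lemma norm_row_le p (h : 'C^p) (d : R) : 0 <= d ->
  (forall l, normc (h 0 l) <= d) -> `|h| <= d%:C.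
Proof.
move=> d0 hd; have [h0|] := eqVneq (mx_norm h) 0; first by rewrite [`|h|]h0 ler0c.
by move=> /mx_norm_neq0[[i j] /= hE]; rewrite [`|h|]hE lecR ord1.
Qed.

(** Finite dimension gives boundedness: expand [h] in the standard basis. *)
Lemma linear_row_bounded p (L : {linear 'C^p -> cvps R n}) :
  exists C : R, forall (h : 'C^p) (d : R),
    (forall l, normc (h 0 l) <= d) -> cvps_norm (L h) <= C * d.
Proof.
exists (\sum_(l < p) cvps_norm (L 'e_l)) => h d hd.
rewrite [h in L h]row_sum_delta linear_sum mulr_suml.
apply: (@le_trans _ _ (\sum_(l < p) cvps_norm (L (h 0 l *: 'e_l)))).
  rewrite -lecR rmorph_sum -cvps_normrE; exact: ler_norm_sum.
apply: ler_sum => l _; rewrite linearZ cvps_normZ mulrC.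
by rewrite ler_wpM2l// cvps_norm_ge0.
Qed.

Lemma analytic_lip_piece p (Omega : set 'C^p) (F : 'C^p -> cvps R n) :
  analytic_map Omega F -> Omega `<=` \bigcup_k lip_piece Omega F k.
Proof.
move=> anF x Ox; have [L FL] := anF x Ox.
have [C LC] := linear_row_bounded L.
(* The little-o with constant 1, so that [C + 1] becomes a Lipschitz constant at [x]. *)
have [r r0 Fr] : exists2 r : R, 0 < r & forall h : 'C^p,
    (forall l, normc (h 0 l) < r) -> `|F (x + h) - (F x + L h)| <= `|h|.
  apply: near0_row; near=> h.
  rewrite [F (x + h)]FL addrC addKr -[leRHS]mul1r; near: h.
  exact: (littleoP _ ltr01).
(* The sum dominates each of [C + 1], [r^-1] and the coordinate moduli. *)
pose k := (Num.truncn (C + 1) + Num.truncn r^-1 +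
  \sum_(l < p) Num.truncn (normc (x ord0 l)))%N.+1.
have kP (y : R) : (Num.truncn y < k)%N -> y <= k%:R.
  by move=> yk; rewrite (le_trans (ltW (truncnS_gt _)))// ler_nat.
exists k => //; split=> // [l|h d d0 dk hd].
  by apply: kP; rewrite /k ltnS (bigD1 l)//= addnCA leq_addr.
have hr l : normc (h 0 l) < r.
  apply: (le_lt_trans (hd l)); apply: (le_lt_trans dk).
  rewrite invf_plt ?posrE// -natr1 (le_lt_trans (kP _ _)) ?ltrDl//.
  by rewrite /k ltnS addnAC leq_addl.
have := Fr h hr; move=> /le_trans => /(_ _ (norm_row_le d0 hd)).
rewrite cvps_normrE lecR => FLd.
have -> : F (x + h) - F x = F (x + h) - (F x + L h) + L h.
  by rewrite opprD addrA addrNK.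
apply: (le_trans (cvps_normD _ _)); apply: (le_trans (lerD FLd (LC _ _ hd))).
by rewrite -[X in X + _]mul1r -mulrDl ler_wpM2r// addrC kP// /k ltnS -addnA leq_addr.
Unshelve. all: by end_near.
Qed.

End analytic_pieces.

(** * Diagonal series and countable unions of thin sets *)

Section thin_union.
Variables (R : realType) (n : nat) (l0 : 'I_n).

Definition diag_index (m : nat) : mindex n := [ffun=> m].

(** The series of [c m * (z_1 ... z_n) ^ m]; the coordinate [l0] reads off the only possible [m]. *)
Definition diag_series (c : nat -> R) (J : mindex n) : R[i] :=
  if J == diag_index (J l0) then (c (J l0))%:C else 0.

Lemma diag_index_inj : injective diag_index.
Proof. by move=> m m' /ffunP/(_ l0); rewrite !ffunE. Qed.

Lemma diag_seriesE c m : diag_series c (diag_index m) = (c m)%:C.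
Proof. by rewrite /diag_series ffunE eqxx. Qed.

Lemma diag_series0 c J : ~ range diag_index J -> diag_series c J = 0.
Proof.
move=> nJ; rewrite /diag_series; case: eqP => // JE.
by exfalso; apply: nJ; exists (J l0).
Qed.

Lemma diag_series_convergent c : (forall m, 0 <= c m <= 1) ->
  diag_series c \in @convergent_pred R n.
Proof.
move=> c01; apply/asboolP/nbhs_ballP; exists (2^-1)%:C.
  by rewrite /= ltcR invr_gt0.
move=> z [_ /= zb].
have z2 l : normc (z 0 l) <= 2^-1.
  have := zb 0 l; rewrite mxE -ball_normE/= sub0r normrN ltcR => /ltW; exact.
rewrite /summable; pose u J := normc (diag_series c J * mmonom z J).
have -> : (\esum_(J in setT) `|(u J)%:E| =
    \esum_(J in range diag_index) (u J)%:E)%E.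
  rewrite [RHS]esum_mkcond; apply: eq_esum => J _ /=.
  rewrite ger0_norm ?normc_ge0//; case: ifPn => // /negP JN.
  by rewrite /u diag_series0 ?mul0r ?normc0// => /mem_set.
rewrite esum_image; last by move=> m m' _ _; exact: diag_index_inj.
apply: (@le_lt_trans _ _ (\esum_(m in [set: nat]) (2 / (2 ^ (m + 1))%:R)%:E)%E).
  apply: le_esum => m _; rewrite lee_fin /u diag_seriesE normcM normc_real.
  have /andP[c0 c1] := c01 m; rewrite ger0_norm//.
  apply: (@le_trans _ _ (normc (mmonom z (diag_index m)))).
    by rewrite ler_piMl// normc_ge0.
  have nX (x : R[i]) k : normc (x ^+ k) = normc x ^+ k.
    elim: k => [|k IH]; first by rewrite !expr0 normc1.
    by rewrite !exprS normcM IH.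
  rewrite /mmonom (big_morph (@normc R) (@normcM R) (@normc1 R)).
  have -> : 2 / (2 ^ (m + 1))%:R = 2^-1 ^+ m :> R.
    by rewrite addn1 expnS natrM invfM mulrA divff ?mul1r// natrX exprVn.
  (* The factor at [l0] alone supplies [2^-1 ^+ m]; the others are at most 1. *)
  rewrite (bigD1 l0)//= nX ffunE -[leRHS]mulr1.
  apply: ler_pM; rewrite ?exprn_ge0 ?normc_ge0 ?prodr_ge0//.
  - by move=> l _; exact: normc_ge0.
  - by rewrite lerXn2r ?nnegrE ?normc_ge0// invr_ge0.
  - apply: prodr_ile1 => l _; rewrite normc_ge0 nX exprn_ile1 ?normc_ge0//.
    by rewrite (le_trans (z2 l))// invf_le1// ler1n.
rewrite -nneseries_esumT; last by move=> m; rewrite lee_fin divr_ge0.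
rewrite (cvg_lim _ (@cvg_geometric_eseries_half R 2 0)) ?ltry//.
Qed.

Lemma thin_bigcup (P : nat -> set (cvps R n)) :
  (forall k, thin (P k)) -> exists f, forall k, ~ P k f.
Proof.
move=> thinP.
(* Injectivity of [pickle] makes the blocks of exponents disjoint, so their values can be prescribed
   independently. *)
have [v vP] := choice (fun k => thinP k (fun j => diag_index (pickle (k, j)))).
pose c m := if unpickle m is Some (k, j) then v k j else 0.
have c01 m : 0 <= c m <= 1.
  rewrite /c; case: unpickle => [[k j]|]; first exact: (vP k).1.
  by rewrite lexx ler01.
exists (Cvps (diag_series_convergent c01)) => k Pf.
by apply: (vP k).2 Pf _ => j /=; rewrite diag_seriesE /c pickleK.
Qed.

End thin_union.

Theorem theorem6 (R : realType) (n : nat) (hn : (0 < n)%N) :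
  analytic_Baire_space (cvps R n).
Proof.
move=> [A [cA anA AT]].
(* [choice] needs pieces for every [S]; outside [A] they are empty. *)
have piece S : exists P : nat -> set (cvps R n),
    (forall k, thin (P k)) /\ (A S -> S `<=` \bigcup_k P k).
  have [/anA [p [D [F [_ _ anF ->]]]]|nAS] := pselect (A S).
    exists (fun k => F @` lip_piece D F k); split=> [k|_ _ [x Ox <-]].
      exact: thin_lip_piece.
    by have [k _ xk] := analytic_lip_piece anF Ox; exists k => //; exists x.
  by exists (fun=> set0); split=> // k J; exists (fun=> 0);
    split=> // j; rewrite lexx ler01.
have [P PP] := choice piece.
have /pfcard_geP[A0|[s]] := cA.
  by have : [set: cvps R n] 0 by []; rewrite -AT A0 bigcup_set0.
(* All pieces of all subspaces, merged into one sequence of thin sets. *)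
pose Q m := if unpickle m is Some (i, k) then P (s i) k else set0.
have [m|f fQ] := @thin_bigcup R n (Ordinal hn) Q.
  rewrite /Q; case: unpickle => [[i k]|]; first exact: (PP _).1.
  by move=> J; exists (fun=> 0); split=> // j; rewrite lexx ler01.
have : [set: cvps R n] f by [].
rewrite -AT => -[S AS Sf].
have [i _ iS] := 'surj_s AS.
have [k _ Pf] := (PP S).2 AS _ Sf.
by apply: (fQ (pickle (i, k))); rewrite /Q pickleK iS.
Qed.
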